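(* For every real $0<\epsilon<1$ and all integers $n\ge 2/\epsilon$ and $2\le k\le \epsilon n$, there exists a feasible irredundant (circular) heterogeneous PV graph $\vec G_R$ with $n$ sites and $k$ carriers such that $$\mathcal M(\vec G_R)\ >\ \tfrac14(1-\epsilon)^2\,n^2\,(k-2).$$ (This holds even though the agent knows $\vec G_R$, $n$ and $k$ and has unlimited memory.)
   Context: A PV (periodically varying) system consists of a finite set $S$ of $n$ sites and a set $C$ of $k\le n$ carriers. Each carrier $c$ has a route $\pi(c)=\langle x_0,\dots,x_{p(c)-1}\rangle$, a finite sequence of sites of length $p(c)\ge1$ called its period; $\pi(c)[j]=x_{j\bmod p(c)}$. At each time $t\in\mathbb N$ carrier $c$ is at $\pi(c)[t]$ and moves to $\pi(c)[t+1]$. The PV graph $\vec G_R$ is the directed edge-labelled multigraph on $S$ with edges $(x_i,x_{i+1},i)$, $0\le i<p(c)$, for every carrier. The system is homogeneous if all $p(c)$ are equal, heterogeneous otherwise. A route is simple if $\pi(c)[i]\ne\pi(c)[i+1]$ for all $i$ and, whenever $\pi(c)[i]=\pi(c)[j]$ with $0\le i<j<p(c)$, then $\pi(c)[i+1]\ne\pi(c)[j+1]$. A route is irredundant (circular) if it is simple and the directed multigraph it describes is either a simple cycle (the sites $x_0,\dots,x_{p(c)-1}$ are distinct) or a virtual cycle, i.e. the closed walk of a simple traversal of a tree (each tree edge traversed once in each direction); in particular $p(c)\le 2(n-1)$. A PV graph is irredundant if all its routes are irredundant. An exploring agent is injected at time $0$ at a site of $\mathrm{start}(\vec G_R)=\{\pi(c)[0]:c\in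 C\}$; if at time $t$ it is at site $x$ it must either ride one step with some carrier $c$ with $\pi(c)[t]=x$ (one move) or halt; it cannot wait. A strategy solves PVG-Exploration of $\vec G_R$ if from every injection site the agent visits all sites and halts in finite time. $\vec G_R$ is feasible if from the starting point of every carrier some realizable walk visits all sites. For feasible $\vec G_R$, $\mathcal M(\vec G_R)$ denotes the minimum, over all deterministic strategies solving PVG-Exploration of $\vec G_R$ (which may use full knowledge of $\vec G_R$ and unlimited memory), of the maximum over injection sites of the number of moves performed. *)

(* Defs.v *)
From mathcomp Require Import all_boot.
Set Implicit Arguments. Unset Strict Implicit. Unset Printing Implicit Defensive.

Section Routes.
Variable S : eqType.

(* pi(c)[t] = x_{t mod p(c)}; the default d is never used when p(c) >= 1 *)
Definition route_at (r : seq S) (d : S) (t : nat) : S := nth d r (t %% size r).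

Definition simple_route (r : seq S) : Prop :=
  forall d : S,
  (forall i, i < size r -> route_at r d i <> route_at r d i.+1) /\
  (forall i j, i < j -> j < size r -> route_at r d i = route_at r d j ->
     route_at r d i.+1 <> route_at r d j.+1).

Definition route_edges (r : seq S) (d : S) : seq (S * S) :=
  [seq (route_at r d i, route_at r d i.+1) | i <- iota 0 (size r)].

Definition simple_cycle (r : seq S) : Prop := uniq r.

(* virtual cycle: closed walk of a simple traversal of a tree.
   For a simple route, this says: every traversed edge is also traversed in
   the reverse direction (each undirected edge traversed once in each
   direction, since a simple route uses each directed edge at most once),
   and the underlying undirected graph on the visited sites -- connected,
   being traversed by a closed walk -- has exactly (#sites - 1) edges, i.e.
   it is a tree. *)
Definition virtual_cycle (r : seq S) : Prop :=
  forall d : S,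
  (forall e, e \in route_edges r d -> (e.2, e.1) \in route_edges r d) /\
  size (undup (route_edges r d)) = 2 * (size (undup r)).-1.

Definition irredundant_route (r : seq S) : Prop :=
  simple_route r /\ (simple_cycle r \/ virtual_cycle r).
End Routes.

(* A PV graph with n sites 'I_n and k carriers 'I_k: each carrier's route. *)
Definition pvg (n k : nat) := 'I_k -> seq 'I_n.

Section PV.
Variables n k : nat.
Variable G : pvg n k.

Definition well_formed : Prop := forall c, 0 < size (G c).

Definition heterogeneous : Prop := exists c c', size (G c) <> size (G c').

Definition irredundant : Prop := forall c, irredundant_route (G c).

Definition is_start (x : 'I_n) : Prop := exists c, ohead (G c) = Some x.

Fixpoint run (t : nat) (x : 'I_n) (cs : seq 'I_k) : option (seq 'I_n) :=
  match cs with
  | [::] => Some [::]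
  | c :: cs' =>
      if route_at (G c) x t == x then
        let y := route_at (G c) x t.+1 in
        omap (cons y) (run t.+1 y cs')
      else None
  end.

Definition explores (x : 'I_n) (cs : seq 'I_k) : Prop :=
  exists p, run 0 x cs = Some p /\ forall y : 'I_n, y \in x :: p.

Definition feasible : Prop :=
  forall x, is_start x -> exists cs, explores x cs.

(* A deterministic agent with full knowledge of G and unlimited memory
   faces no non-determinism, so its behaviour from each injection site is
   a fixed finite sequence of moves before halting. *)
Definition strategy := 'I_n -> seq 'I_k.

Definition solves (s : strategy) : Prop :=
  forall x, is_start x -> explores x (s x).
End PV.

(* Main.v *)
Require Import Defs.
From mathcomp Require Import all_boot.
From mathcomp Require Import zify.
From Stdlib Require Import Reals Lra.

Set Implicit Arguments. Unset Strict Implicit. Unset Printing Implicit Defensive.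

(** Take coprime periods [p] and [q] and let [r <= q] "petal" carriers of period
    [q], each with a site of its own, follow the same cycle with pairwise
    different phases, so that no two petals ever meet.  Every petal meets the
    "stem" carrier, of period [p], in a single common site, hence exactly once
    every [p * q] steps.  An agent starting on the stem has to ride every petal
    and to come back from all of them but the last one, which costs more than
    [(r - 1) * (p * q)] moves.  The sites allow [p + q = n - r + 2], so [p] and
    [q] can be taken close to [(n - r) / 2].  When [k] exceeds [n / 3] or so, the
    bound [(k - 2) (n - k)^2 / 4] decreases with [k], and it is enough to use
    about [n / 3] petals, the other carriers being copies of the stem.  For
    [k = 2] or [n <= 7] the trivial bound of [n - 1] moves suffices. *)

(** Distinct sites form a simple cycle; length above 1 keeps the wrap-around step from being a
    loop. *)
Lemma uniq_irredundant (S : eqType) (r : seq S) :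
  uniq r -> 1 < size r -> irredundant_route r.
Proof.
move=> Ur r_gt1; split; last by left.
have r_gt0 : 0 < size r by apply: ltnW.
move=> d; rewrite /route_at; split=> [i ltir /eqP | i j ltij ltjr /eqP].
  rewrite nth_uniq ?ltn_pmod // modn_small //.
  have [lt1|le1] := ltnP i.+1 (size r); first by rewrite modn_small //; lia.
  have -> : i.+1 = size r by lia.
  by rewrite modnn; lia.
have ltir := ltn_trans ltij ltjr.
by rewrite nth_uniq ?ltn_pmod // (modn_small ltir) (modn_small ltjr); lia.
Qed.

(** * Walks that change carriers *)

Section Walks.
Variables (n k : nat) (G : pvg n k).

Lemma run_size t x cs p : run G t x cs = Some p -> size p = size cs.
Proof.
elim: cs t x p => [|c cs IH] t x p /=; first by case=> <-.
case: ifP => // _; case E: (run _ _ _ _) => [p'|] //= [<-] /=.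
by rewrite (IH _ _ _ E).
Qed.

Lemma run_cat t x cs cs' p p' :
    run G t x cs = Some p -> run G (t + size cs) (last x p) cs' = Some p' ->
  run G t x (cs ++ cs') = Some (p ++ p').
Proof.
elim: cs t x p => [|c cs IH] t x p /=; first by case=> <-; rewrite addn0.
case: ifP => // _; case E: (run _ _ _ _) => [p1|] //= [<-] /=.
by rewrite -addSnnS => /(IH _ _ _ E) ->.
Qed.

Variable pos : 'I_k -> nat -> 'I_n.
Hypothesis posE : forall c d t, route_at (G c) d t = pos c t.

(** Indexed by carriers and times rather than sites, so that rides and changes of carrier compose.
    Time advances by exactly the number of moves, as the agent cannot wait. *)
Definition transfer c t c' t' :=
  exists cs p, [/\ run G t (pos c t) cs = Some p,
                   last (pos c t) p = pos c' t' & t' = t + size cs].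

Lemma transfer_ride c t t' : t <= t' -> transfer c t c t'.
Proof.
move=> le_tt'; rewrite -(subnKC le_tt'); elim: (t' - t) => [|d [cs [p [H1 H2 H3]]]].
  by exists [::], [::]; rewrite addn0.
exists (cs ++ [:: c]), (p ++ [:: pos c (t + d.+1)]); split.
- by apply: (run_cat H1); rewrite /= -H3 H2 !posE eqxx addnS.
- by rewrite last_cat.
- by rewrite size_cat /= addnA -H3; lia.
Qed.

Lemma transfer_meet c c' t : pos c t = pos c' t -> transfer c t c' t.
Proof. by move=> e; exists [::], [::]; rewrite addn0. Qed.

Lemma transfer_trans c t c1 t1 c2 t2 :
  transfer c t c1 t1 -> transfer c1 t1 c2 t2 -> transfer c t c2 t2.
Proof.
move=> [cs [p [H1 H2 H3]]] [cs' [p' [H1' H2' H3']]].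
exists (cs ++ cs'), (p ++ p'); split.
- by apply: (run_cat H1); rewrite -H3 H2.
- by rewrite last_cat H2.
- by rewrite size_cat addnA -H3.
Qed.

Lemma transfer_feasible :
    well_formed G ->
    (forall c t y, exists c' t', transfer c t c' t' /\ pos c' t' = y) ->
  feasible G.
Proof.
move=> wfG tr x [c hc].
have x0 : x = pos c 0.
  move: hc (wfG c); rewrite -(posE c x) /route_at mod0n.
  by case: (G c) => [|a l] //= [->].
have all_sites (ys : seq 'I_n) t c1 : exists cs p,
    run G t (pos c1 t) cs = Some p /\ forall y, y \in ys -> y \in pos c1 t :: p.
  elim: ys t c1 => [|y ys IH] t c1; first by exists [::], [::].
  have [c' [t' [[cs [p [H1 H2 H3]]] H4]]] := tr c1 t y.
  have [cs' [p' [H1' H2']]] := IH t' c'.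
  exists (cs ++ cs'), (p ++ p'); split; first by apply: (run_cat H1); rewrite -H3 H2.
  move=> z; rewrite inE => /predU1P[->|/H2'].
    by rewrite -cat_cons mem_cat -H4 -H2 mem_last.
  rewrite -cat_cons mem_cat inE => /predU1P[->|->]; last by rewrite orbT.
  by rewrite -H2 mem_last.
have [cs [p [Hr Hp]]] := all_sites (enum 'I_n) 0 c.
by exists cs, p; rewrite x0; split=> // y; apply: Hp; rewrite mem_enum.
Qed.

End Walks.

(** * The flower graph *)

Section Flower.

(* Carriers [c >= r] all ride the main cycle [0, ..., p - 1].  Carrier [i < r]
   rides, shifted by [i], the cycle
   [0, p, ..., p + q - 3, p + q - 2 + i], whose last site is its own. *)
Variables n k p q r : nat.
Hypotheses (p_gt1 : 1 < p) (q_gt1 : 1 < q) (co_pq : coprime p q).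
Hypotheses (r_gt0 : 0 < r) (le_rq : r <= q) (lt_rk : r < k).
Hypothesis n_eq : n.+1 = p + q - 2 + r.

Definition petal_site i j := if j == 0 then 0 else p.-1 + j + (if j == q.-1 then i else 0).

Definition flower_site (o : option 'I_r) (t : nat) : nat :=
  if o is Some i then petal_site i ((t + i) %% q) else t %% p.

Definition flower_period (o : option 'I_r) := if o is Some _ then q else p.

Definition kind (c : 'I_k) : option 'I_r := insub (c : nat).

Definition flower_pos (c : 'I_k) (t : nat) : 'I_n.+1 := inord (flower_site (kind c) t).

Definition flower : pvg n.+1 k := fun c => mkseq (flower_pos c) (flower_period (kind c)).

Let p_gt0 : 0 < p. Proof. exact: ltnW. Qed.
Let q_gt0 : 0 < q. Proof. exact: ltnW. Qed.

(** The offset [i] moves only the last index, whose site lies above all the others, so a site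
    determines its index even across different petals. *)
Lemma petal_site_inj i j a b :
  a < q -> b < q -> petal_site i a = petal_site j b -> a = b.
Proof.
move=> lta ltb; rewrite /petal_site.
by do ?[case: eqP => ?]; lia.
Qed.

Lemma petal_site_lt (i : 'I_r) a : a < q -> petal_site i a < n.+1.
Proof.
have := ltn_ord i => lti lta; rewrite /petal_site n_eq.
by do ?[case: eqP => ?]; lia.
Qed.

Lemma petal_site_lt_p i a : petal_site i a < p -> a = 0.
Proof. by rewrite /petal_site; case: eqP => //; lia. Qed.

Lemma flower_site_lt o t : flower_site o t < n.+1.
Proof.
case: o => [i|] /=; first exact/petal_site_lt/ltn_pmod.
by have := ltn_pmod t p_gt0; lia.
Qed.

Lemma flower_posE c t : flower_pos c t = flower_site (kind c) t :> nat.
Proof. by rewrite inordK // flower_site_lt. Qed.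

Lemma flower_period_gt1 o : 1 < flower_period o.
Proof. by case: o. Qed.

Lemma flower_size c : size (flower c) = flower_period (kind c).
Proof. by rewrite size_mkseq. Qed.

Lemma flower_well_formed : well_formed flower.
Proof. by move=> c; rewrite flower_size ltnW ?flower_period_gt1. Qed.

Lemma flower_route c d t : route_at (flower c) d t = flower_pos c t.
Proof.
rewrite /route_at flower_size nth_mkseq; last by rewrite ltn_pmod // ltnW ?flower_period_gt1.
by rewrite /flower_pos; case: (kind c) => [i|] /=; rewrite ?modn_mod ?modnDml.
Qed.

Lemma flower_irredundant : irredundant flower.
Proof.
move=> c; apply: uniq_irredundant; last by rewrite flower_size flower_period_gt1.
apply/mkseq_uniqP => a b; rewrite !inE => lta ltb /(congr1 val) /=.
rewrite !flower_posE; case: (kind c) lta ltb => [i|] /= lta ltb; last by rewrite !modn_small.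
move/petal_site_inj; rewrite !ltn_pmod // => /(_ isT isT) /eqP.
by rewrite eqn_modDr !modn_small // => /eqP.
Qed.

Definition petal (i : 'I_r) : 'I_k := widen_ord (ltnW lt_rk) i.
Definition stem : 'I_k := Ordinal lt_rk.

Lemma kind_petal i : kind (petal i) = Some i.
Proof. by rewrite /kind insubT //= => H; congr Some; apply: val_inj. Qed.

Lemma kind_stem : kind stem = None.
Proof. by rewrite /kind insubF //= ltnn. Qed.

Lemma kind_eq_site c c' t : kind c = kind c' -> flower_pos c t = flower_pos c' t.
Proof. by rewrite /flower_pos => ->. Qed.

Lemma kindP c : kind c = None \/ exists i, kind c = Some i.
Proof. by case: (kind c) => [i|]; [right; exists i | left]. Qed.

Lemma flower_heterogeneous : heterogeneous flower.
Proof.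
exists stem, (petal (Ordinal r_gt0)); rewrite !flower_size kind_stem kind_petal /= => pq.
by move: co_pq p_gt1; rewrite pq /coprime gcdnn => /eqP->.
Qed.

(** * Meetings between carriers *)

Lemma petals_never_meet i j t :
  flower_site (Some i) t = flower_site (Some j) t -> i = j.
Proof.
move=> /= /petal_site_inj; rewrite !ltn_pmod // => /(_ isT isT) /eqP.
rewrite eqn_modDl !modn_small ?(leq_trans (ltn_ord _) le_rq) // => /eqP.
exact: val_inj.
Qed.

(** Away from index 0 a petal is at a site at least [p], so a meeting can only happen at site 0. *)
Lemma petal_meets_stem i t :
  flower_site (Some i) t = flower_site None t <-> (p %| t) /\ (q %| t + i).
Proof.
rewrite /dvdn /=; split=> [E|[/eqP-> /eqP->]]; last by rewrite /petal_site.
have /petal_site_lt_p E0 : petal_site i ((t + i) %% q) < p by rewrite E ltn_pmod.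
by move: E; rewrite E0 /petal_site /= => <-.
Qed.

Lemma petal_meets_stem_gap i e t :
    e < t -> flower_site (Some i) e = flower_site None e ->
    flower_site (Some i) t = flower_site None t ->
  e + p * q <= t.
Proof.
move=> lt_et /petal_meets_stem[pe qe] /petal_meets_stem[pt qt].
suff: p * q <= t - e by lia.
apply: dvdn_leq; first by rewrite subn_gt0.
rewrite Gauss_dvd // dvdn_sub //=.
by rewrite -(subnDr i) dvdn_sub.
Qed.

Lemma petal_meets_stem_late i t :
  exists2 t', t <= t' & flower_site (Some i) t' = flower_site None t'.
Proof.
(* The Chinese remainder solution of [t' = 0] mod [p] and [t' = - i] mod [q], pushed past [t] by a
   multiple of both periods. *)
exists (chinese p q 0 (q - i) + t * (p * q)).
  by have : 0 < p * q; [rewrite muln_gt0 p_gt0 | nia].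
have leiq : i <= q by apply: leq_trans (ltnW (ltn_ord i)) le_rq.
have pD : p %| t * (p * q) by rewrite dvdn_mull ?dvdn_mulr.
have qD : q %| t * (p * q) by rewrite !dvdn_mull.
apply/petal_meets_stem; split.
  by rewrite dvdn_addl // /dvdn chinese_modl // mod0n.
rewrite addnAC dvdn_addl // /dvdn -modnDml chinese_modr //.
by rewrite modnDml subnK // modnn.
Qed.

(** * Feasibility of the flower *)

Lemma flower_transfer c t c' :
  exists2 t', t <= t' & transfer flower flower_pos c t c' t'.
Proof.
pose tr := @transfer_trans _ _ flower flower_pos.
pose ride := transfer_ride flower_route.
pose meet := @transfer_meet _ _ flower flower_pos.
(* The stem is the hub through which any two carriers are connected. *)
have to_stem c1 t1 : exists2 t', t1 <= t' & transfer flower flower_pos c1 t1 stem t'.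
  case: (kindP c1) => [k1|[i k1]].
    by exists t1 => //; apply: meet; apply: kind_eq_site; rewrite k1 kind_stem.
  have [t' le_t E] := petal_meets_stem_late i t1; exists t' => //.
  apply: tr (ride c1 _ _ le_t) _; apply: meet.
  by apply: val_inj; rewrite /= !flower_posE k1 kind_stem.
have from_stem c1 t1 : exists2 t', t1 <= t' & transfer flower flower_pos stem t1 c1 t'.
  case: (kindP c1) => [k1|[i k1]].
    by exists t1 => //; apply: meet; apply: kind_eq_site; rewrite k1 kind_stem.
  have [t' le_t E] := petal_meets_stem_late i t1; exists t' => //.
  apply: tr (ride stem _ _ le_t) _; apply: meet.
  by apply: val_inj; rewrite /= !flower_posE k1 kind_stem.
have [t1 le1 T1] := to_stem c t; have [t2 le2 T2] := from_stem c' t1.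
by exists t2; [apply: leq_trans le1 le2 | apply: tr T1 T2].
Qed.

Lemma petal_at (i : 'I_r) j : j < q -> exists t, (t + i) %% q = j.
Proof.
move=> ltj; have leiq : i <= q by apply: leq_trans (ltnW (ltn_ord i)) le_rq.
by exists (j + (q - i)); rewrite -addnA subnK // modnDr modn_small.
Qed.

Lemma flower_covers (y : 'I_n.+1) : exists c t, flower_pos c t = y.
Proof.
have lt_y := ltn_ord y.
case: (ltnP y p) => [lt_yp | le_py].
  exists stem, y; apply: val_inj.
  by rewrite /= flower_posE kind_stem /= modn_small.
(* Sites below [p + q - 2] lie on every petal, so petal 0 will do; each later site belongs to one
   petal only. *)
have [i [j [ltj Ej]]] : exists (i : 'I_r) j, j < q /\ petal_site i j = y.
  case: (ltnP y (p + q - 2)) => [lt_y2 | le_y2].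
    exists (Ordinal r_gt0), (y - p.-1).
    by rewrite /petal_site /=; do ?[case: eqP => ?]; lia.
  have lt_i : y - (p + q - 2) < r by lia.
  by exists (Ordinal lt_i), q.-1; rewrite /petal_site /= eqxx; case: eqP => ?; lia.
have [t Et] := petal_at i ltj.
by exists (petal i), t; apply: val_inj; rewrite /= flower_posE kind_petal /= Et.
Qed.

Lemma flower_recurs c t s :
  exists2 t', t <= t' & flower_pos c t' = flower_pos c s.
Proof.
exists (t * flower_period (kind c) + s).
  by have := flower_period_gt1 (kind c); nia.
by rewrite /flower_pos; case: (kind c) => [i|] /=; rewrite -?addnA modnMDl.
Qed.

Lemma flower_feasible : feasible flower.
Proof.
apply: (transfer_feasible flower_route flower_well_formed) => c t y.
have [c' [s <-]] := flower_covers y.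
have [t1 le1 T1] := flower_transfer c t c'.
have [t2 le2 E2] := flower_recurs c' t1 s.
exists c', t2; split=> //.
exact: (transfer_trans T1 (transfer_ride flower_route c' le2)).
Qed.

(** * Lower bound for the flower *)

Definition tip (i : 'I_r) : 'I_n.+1 := inord (p + q - 2 + i).

Lemma tip_private c t i : flower_pos c t = tip i -> kind c = Some i.
Proof.
move/(congr1 (@nat_of_ord _)); rewrite flower_posE inordK; last by have := ltn_ord i; lia.
case: (kindP c) => [k1|[j k1]]; rewrite k1 /=.
  by have := ltn_pmod t p_gt0; lia.
have := ltn_pmod (t + j) q_gt0; move: (_ %% q) => a lta.
rewrite /petal_site; do ?[case: eqP => ?] => E; try lia.
by congr Some; apply: val_inj => /=; lia.
Qed.

(* The agent arrives at time [t] on a carrier of kind [o], after having ridden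
   [v] different petals: each stay on a petal lasts at least [p * q], the gap
   between two meetings of that petal with the stem. *)
Definition delayed (o : option 'I_r) (t v : nat) : Prop :=
  match o with
  | None => v * (p * q) <= t
  | Some i => exists e, [/\ e < t, flower_site (Some i) e = flower_site None e
                          & v.-1 * (p * q) <= e]
  end.

(** Induction on the remaining moves, [U] being the petals ridden so far. Each move preserves
    [delayed]; at the end all tips have been seen, so [U] contains all [r] petals, and only the last
    one need not be left. *)
Lemma flower_run_bound cs t c x ps (U : {set 'I_r}) :
    run flower t x cs = Some ps -> flower_pos c t = x ->
    delayed (kind c) t #|U| -> (forall i, kind c = Some i -> i \in U) ->
    (forall i, i \in U \/ tip i \in ps) ->
  r.-1 * (p * q) < t + size cs.
Proof.
elim: cs t c x ps U => [|c' cs IH] t c x ps U /=.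
  move=> [<-] _ Hd _ cov; rewrite addn0.
  have cU : #|U| = r.
    rewrite -[RHS]card_ord; apply: eq_card => i; rewrite !inE.
    by case: (cov i).
  move: Hd; rewrite cU; case: (kind c) => [i [e [lt_e _ le_e]]|/=].
    exact: leq_ltn_trans le_e lt_e.
  have : 0 < p * q by rewrite muln_gt0 p_gt0.
  by move: r_gt0; case: (r) => // r' _ pq; rewrite mulSn /=; lia.
rewrite flower_route; case: eqP => // c't; rewrite flower_route.
case E: (run _ _ _ _) => [ps'|] //= [<-] ct Hd HU cov.
pose V := if kind c' is Some i then i |: U else U.
have sUV : U \subset V by rewrite /V; case: (kind c') => // i; apply: subsetUr.
rewrite -addSnnS; apply: (IH _ c' _ _ V E) => //; first last.
- move=> i; case: (cov i) => [iU|]; first by left; apply: (subsetP sUV).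
  rewrite inE => /predU1P[/esym/tip_private k'|]; last by right.
  by left; rewrite /V k' setU11.
- by move=> i k'; rewrite /V k' setU11.
have meet : flower_site (kind c') t = flower_site (kind c) t.
  by rewrite -!flower_posE ct c't.
rewrite /V; case: (kindP c') => [k'|[i k']]; case: (kindP c) => [k0|[j k0]];
  rewrite k' k0 in meet Hd HU *.
- exact: leq_trans Hd _.
(* Leaving petal [j]: the boarding time [e] and the time [t] are distinct meetings with the stem. *)
- have [e [lt_e He le_e]] := Hd.
  have gap := petal_meets_stem_gap lt_e He (esym meet).
  have : 0 < #|U| by apply/card_gt0P; exists j; apply: HU.
  rewrite /=; case: #|U| le_e => // u /=; rewrite mulSn; lia.
(* Boarding a petal at time [t]: the predecessor in [delayed] discounts the petal just boarded. *)
- exists t; split=> //; apply: leq_trans Hd.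
  rewrite leq_mul2r; apply/orP; right.
  by rewrite cardsU1; case: (_ \notin _) => //=; rewrite leq_pred.
- have ij := petals_never_meet meet; subst j.
  have -> : i |: U = U by apply/setUidPr; rewrite sub1set HU.
  by have [e [lt_e He le_e]] := Hd; exists e; split=> //; apply: ltnW.
Qed.

Lemma flower_lower_bound (s : strategy n.+1 k) :
  solves flower s -> exists x, is_start flower x /\ r.-1 * (p * q) < size (s x).
Proof.
move=> sol; pose x := flower_pos stem 0.
have st : is_start flower x.
  exists stem; rewrite /flower kind_stem /=.
  by case: (p) p_gt0.
exists x; split=> //; have [ps [Hr Hcov]] := sol x st.
rewrite -[size _]add0n; apply: (@flower_run_bound _ 0 stem x ps set0 Hr) => //.
- by rewrite kind_stem /= cards0.
- by rewrite kind_stem.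
move=> i; right; move: (Hcov (tip i)); rewrite inE => /predU1P[/esym/tip_private|//].
by rewrite kind_stem.
Qed.

End Flower.

(** * A graph for the trivial bound *)

Section Trivial.
Variables n k : nat.
Hypotheses (n_gt1 : 1 < n) (k_gt1 : 1 < k).

(** Carrier 0 goes round all the sites; the others shuttle between sites 0 and 1. *)
Definition cycle_pos (c : 'I_k) (t : nat) : 'I_n.+1 :=
  inord (t %% (if c == 0 :> nat then n.+1 else 2)).

Definition cycles : pvg n.+1 k :=
  fun c => mkseq (cycle_pos c) (if c == 0 :> nat then n.+1 else 2).

Let c0 : 'I_k := Ordinal (ltnW k_gt1).

Lemma cycles_route c d t : route_at (cycles c) d t = cycle_pos c t.
Proof.
rewrite /route_at size_mkseq nth_mkseq; last by case: ifP; rewrite ltn_mod.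
by rewrite /cycle_pos modn_mod.
Qed.

Lemma cycles_well_formed : well_formed cycles.
Proof. by move=> c; rewrite size_mkseq; case: ifP. Qed.

Lemma cycles_start : is_start cycles ord0.
Proof.
exists c0; rewrite /cycles /=; congr Some; apply: val_inj.
by rewrite /= inordK mod0n.
Qed.

Lemma cycles_irredundant : irredundant cycles.
Proof.
move=> c; apply: uniq_irredundant; last by rewrite size_mkseq; case: ifP => _; lia.
apply/mkseq_uniqP => a b; rewrite !inE => lta ltb /(congr1 (@nat_of_ord _)).
rewrite /cycle_pos !modn_small // !inordK //.
  by move: ltb; case: ifP => _; lia.
by move: lta; case: ifP => _; lia.
Qed.

Lemma cycles_feasible : feasible cycles.
Proof.
apply: (transfer_feasible cycles_route cycles_well_formed) => c t y.
(* At multiples of both periods all carriers are together at site 0, where the agent can switch to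
   carrier 0. *)
have pos0 c1 s : 2 * n.+1 %| s -> cycle_pos c1 s = ord0.
  move=> dv; apply: val_inj; rewrite /= /cycle_pos.
  suff /eqP-> : s %% (if c1 == 0 :> nat then n.+1 else 2) == 0 by rewrite inordK.
  by case: ifP => _; apply: dvdn_trans dv; [exact: dvdn_mull | exact: dvdn_mulr].
pose s := t * (2 * n.+1).
have le_ts : t <= s by rewrite /s; lia.
have tr_c : transfer cycles cycle_pos c t c0 s.
  apply: transfer_trans (transfer_ride cycles_route c le_ts) (transfer_meet _ _).
  by rewrite !pos0 // dvdn_mull.
exists c0, (s + y); split.
  exact: (transfer_trans tr_c (transfer_ride cycles_route c0 (leq_addr y s))).
by apply: val_inj; rewrite /cycle_pos /= /s mulnA modnMDl modn_small // inord_val.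
Qed.

Lemma cycles_heterogeneous : heterogeneous cycles.
Proof. by exists c0, (Ordinal k_gt1); rewrite !size_mkseq /=; lia. Qed.

Lemma cycles_lower_bound (s : strategy n.+1 k) :
  solves cycles s -> exists x, is_start cycles x /\ n <= size (s x).
Proof.
move=> sol; exists ord0; split; first exact: cycles_start.
have [ps [/run_size <- cov]] := sol _ cycles_start.
have le : #|'I_n.+1| <= #|ord0 :: ps|.
  by apply/subset_leq_card/subsetP => y _; apply: cov.
by have := leq_trans le (card_size _); rewrite card_ord.
Qed.

End Trivial.

(** * Choice of the parameters *)

Lemma balanced_coprime_split s : 6 < s ->
  exists p q, [/\ 1 < p, 1 < q, coprime p q, p + q = s &
                  (s <= 2 * q) && (s * s <= 4 * (p * q) + 16)].
Proof.
move=> s_gt6; have [s_odd|s_even] := boolP (odd s).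
  by exists s./2, s./2.+1; split; try lia; rewrite coprimenS.
have [h_odd|h_even] := boolP (odd s./2).
  (* With [h = s./2] odd, [h - 1] and [h + 1] are both even, hence the distance 2;
     [4 (h - 2) (h + 2) = s^2 - 16] is where 16 comes from. *)
  exists (s./2 - 2), (s./2 + 2); split; try lia.
  have -> : s./2 + 2 = (s./2 - 2) + 2 * 2 by lia.
  by rewrite /coprime gcdnDl -/(coprime _ _) coprimeMr andbb coprimen2; lia.
exists s./2.-1, s./2.+1; split; try lia; last by nia.
have -> : s./2.+1 = s./2.-1 + 2 by lia.
by rewrite /coprime gcdnDl -/(coprime _ _) coprimen2; lia.
Qed.

(* As a function of [d], [(A + d) (Y - d)^2] is nonincreasing once [3 d >= Y - 2 A]. *)
Lemma cubic_decreasing A Y d : 2 < Y -> d <= Y -> 2 * A <= Y + 1 -> Y <= 2 * A + 1 ->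
  (A + d) * ((Y - d) * (Y - d)) <= A * (Y * Y).
Proof.
move=> Y2 dY AY YA; case: d dY => [|d] dY; first by rewrite addn0 subn0.
set m := Y - d.+1; have -> : Y = m + d.+1 by lia.
nia.
Qed.

Lemma flower_parameters n k : 7 < n -> 2 < k -> k < n ->
  exists p q r, [/\ [/\ 1 < p, 1 < q & coprime p q], [/\ 0 < r, r <= q & r < k],
    n = p + q - 2 + r & (k - 2) * ((n - k) * (n - k)) <= 4 * (r.-1 * (p * q))].
Proof.
move=> n_gt7 k_gt2 lt_kn; pose r := minn k.-1 ((n + 2) %/ 3).
have [p [q [p1 q1 co pqs /andP[le_sq ssq]]]] : exists p q,
    [/\ 1 < p, 1 < q, coprime p q, p + q = n + 2 - r &
        (n + 2 - r <= 2 * q) && ((n + 2 - r) * (n + 2 - r) <= 4 * (p * q) + 16)].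
  by apply: balanced_coprime_split; rewrite /r; lia.
exists p, q, r; split=> //; first by split=> //; rewrite /r in le_sq *; lia.
  by rewrite /r in pqs *; lia.
set s := n + 2 - r in pqs le_sq ssq.
have s6 : 6 < s by rewrite /s /r; lia.
(* Replacing [s] by [s - 3] absorbs the loss of 16. *)
suff H : (k - 2) * ((n - k) * (n - k)) <= r.-1 * ((s - 3) * (s - 3)).
  have : (s - 3) * (s - 3) <= 4 * (p * q) by nia.
  by move=> H1; apply: leq_trans H _; rewrite [leqRHS]mulnCA leq_mul2l H1 orbT.
(* The surplus [k.-1 - r] counts the extra copies of the stem; it is the [d] of
   [cubic_decreasing]. *)
have -> : k - 2 = r.-1 + (k.-1 - r) by rewrite /r; lia.
have -> : n - k = s - 3 - (k.-1 - r) by rewrite /s /r; lia.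
have [lek|ltk] := leqP k.-1 ((n + 2) %/ 3).
  have -> : k.-1 - r = 0 by rewrite /r; lia.
  by rewrite addn0 subn0.
by apply: cubic_decreasing; rewrite /s /r; lia.
Qed.

(** * The bound over the naturals, then over the reals *)

Lemma exists_slow_pvg n k : 1 < k -> k < n ->
  exists G : pvg n k,
    well_formed G /\ heterogeneous G /\ irredundant G /\ feasible G /\
    (forall s : strategy n k, solves G s ->
       exists x, is_start G x /\
         (k - 2) * ((n - k) * (n - k)) < 4 * size (s x)).
Proof.
case: n => [|n] // k_gt1 lt_kn.
have [/andP[n_gt7 k_gt2]|small] := boolP ((7 < n.+1) && (2 < k)).
  have [p [q [r [[p1 q1 co] [r0 rq rk] nE le]]]] := flower_parameters n_gt7 k_gt2 lt_kn.
  exists (@flower n k p q r).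
  split; first exact: flower_well_formed.
  split; first exact: flower_heterogeneous.
  split; first exact: flower_irredundant.
  split; first exact: flower_feasible.
  move=> s /(flower_lower_bound p1 q1 co r0 rq rk nE)[x [st lt]]; exists x; split=> //.
  by apply: leq_ltn_trans le _; rewrite ltn_pmul2l.
have n_gt1 : 1 < n by lia.
exists (@cycles n k).
split; first exact: cycles_well_formed.
split; first exact: cycles_heterogeneous.
split; first exact: cycles_irredundant.
split; first exact: cycles_feasible.
move=> s /(cycles_lower_bound k_gt1)[x [st le]]; exists x; split=> //.
suff: (k - 2) * ((n.+1 - k) * (n.+1 - k)) < 4 * n by lia.
have [->|k_ne2] := eqVneq k 2; first by rewrite subnn mul0n; lia.
have {small} : n <= 6 by lia.
(* At most 7 sites: a finite check. *)
case: n lt_kn n_gt1 {le st x s} => [|[|[|[|[|[|[|n]]]]]]] //;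
case: k k_gt1 k_ne2 => [|[|[|[|[|[|[|k]]]]]]] //.
Qed.

(* M(G) > B  <=>  every strategy solving PVG-Exploration performs more than
   B moves from some injection site. *)
Theorem mainTheorem8 (eps : R) (n k : nat) :
  (0 < eps)%R -> (eps < 1)%R ->
  (2 / eps <= INR n)%R ->
  (2 <= k)%N -> (INR k <= eps * INR n)%R ->
  exists G : pvg n k,
    well_formed G /\ heterogeneous G /\ irredundant G /\ feasible G /\
    (forall s : strategy n k, solves G s ->
       exists x, is_start G x /\
         (/ 4 * (1 - eps) ^ 2 * INR n ^ 2 * (INR k - 2) < INR (size (s x)))%R).
Proof.
move=> eps0 eps1 _ k_ge2 k_le.
have Rk : (2 <= INR k)%R by move/leP: k_ge2 => /le_INR /=; lra.
have lt_kn : k < n.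
  apply/ltP/INR_lt; have : (0 < INR n)%R by nra.
  nra.
have [G [wf [het [irr [feas low]]]]] := exists_slow_pvg k_ge2 lt_kn.
exists G; do 4![split=> //] => s /low[x [st lt]]; exists x; split=> //.
move/ltP/lt_INR: lt.
rewrite !mult_INR !minus_INR; [|lia|lia].
have -> : INR 4 = 4%R by rewrite /=; lra.
have -> : INR 2 = 2%R by rewrite /=; lra.
(* This is [k <= eps * n] rearranged; nonnegativity allows squaring. *)
have m_ge : (0 <= (1 - eps) * INR n <= INR n - INR k)%R by have := pos_INR n; split; nra.
have sq : (((1 - eps) * INR n) ^ 2 <= (INR n - INR k) * (INR n - INR k))%R by nra.
move=> lt; have := Rmult_le_compat_l (INR k - 2) _ _ ltac:(lra) sq.
rewrite Rpow_mult_distr; lra.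
Qed.
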